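(* Let $\mathbb{F}$ be an algebraically closed field of prime characteristic $p$, let $G$ be a finite group and $N \unlhd G$ a normal subgroup such that $p$ divides $|N|$. Let $\sigma \in \hat{N}$, let $I_G(\sigma)$ be the inertia group of $\sigma$ in $G$, and let $d = [I_G(\sigma):N]$. Let $R$ be a set of representatives of the left cosets of $I_G(\sigma)$ in $G$, let $Q$ be a set of representatives of the left cosets of $N$ in $I_G(\sigma)$, and let $T = RQ = \{rq : r\in R, q\in Q\}$, a set of representatives of the left cosets of $N$ in $G$. Let $\theta \in \hat{G}(\sigma)$ and let $\ell$ be the multiplicity of $\sigma$ in $\mathrm{Res}^G_N\theta$. Then: 1. The decomposition of $\mathrm{Res}^G_N(\mathrm{Ind}^G_N\sigma)$ into irreducible inequivalent subrepresentations is $$\mathrm{Res}^G_N(\mathrm{Ind}^G_N\sigma) \cong \bigoplus_{t\in T}{}^t\sigma \cong d\bigoplus_{r\in R}{}^r\sigma,$$ where the ${}^r\sigma$, $r \in R$, are irreducible and pairwise inequivalent. 2. $\mathrm{Hom}_G(\mathrm{Ind}^G_N\sigma,\mathrm{Ind}^G_N\sigma) \cong \mathbb{F}^d$ as $\mathbb{F}$-vector spaces. 3. $\mathrm{Res}^G_N\theta \cong \ell\bigoplus_{r\in R}{}^r\sigma$.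
   Context: All representations are finite-dimensional over $\mathbb{F}$. $\hat{G}$ (resp. $\hat{N}$) is the set of equivalence classes of irreducible representations of $G$ (resp. $N$) over $\mathbb{F}$; $V_\sigma$ denotes the space of $\sigma$, and $U_\theta$ the space of $\theta$. For a representation $\rho$ and an integer $m\ge 0$, $m\rho$ denotes the direct sum of $m$ copies of $\rho$. Induced representation: for $\sigma\in\hat N$, $\mathrm{Ind}^G_N V_\sigma=\{f:G\to V_\sigma \mid f(gn)=\sigma(n^{-1})f(g)\ \forall n\in N, g\in G\}$ with $G$ acting by left translation, $(g\cdot f)(x)=f(g^{-1}x)$. $\mathrm{Res}^G_N$ denotes restriction to $N$. $\hat{G}(\sigma)=\{\theta\in\hat G \mid V_\sigma \text{ is (isomorphic to) a subrepresentation of } \mathrm{Res}^G_N U_\theta\}$. For $g\in G$, the $g$-conjugate of $\sigma\in\hat N$ is ${}^g\sigma(n)=\sigma(g^{-1}ng)$ for $n\in N$. The inertia group is $I_G(\sigma)=\{g\in G\mid {}^g\sigma\sim\sigma\}$, where $\sim$ denotes equivalence of representations; it contains $N$. The multiplicity of $\sigma$ in $\mathrm{Res}^G_N\theta$ is $\ell=\dim_{\mathbb F}\mathrm{Hom}_N(\sigma,\mathrm{Res}^G_N\theta)$. *)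

(* Defs.v *)
From HB Require Import structures.
From mathcomp Require Import all_boot all_order all_algebra all_fingroup.
From mathcomp Require Import all_solvable all_field all_character.
From mathcomp Require Import boolp.

Set Implicit Arguments.
Unset Strict Implicit.
Unset Printing Implicit Defensive.

Import GroupScope GRing.Theory.
Local Open Scope ring_scope.

(* A matrix representation rG of degree n acts on row vectors from the right, *)
(* by v |-> v *m rG g, and mxmodule, mxsimple, submod_repr and mx_rsim refer  *)
(* to this right module. The left G-module that it stands for is 'rV_n with   *)
(* g acting by lact rG g; both have the same submodules and the same          *)
(* G-linear maps.                                                             *)
Definition lact (F : fieldType) (gT : finGroupType) (G : {group gT}) (n : nat)
    (rG : mx_representation F G n) (g : gT) (v : 'rV[F]_n) : 'rV[F]_n :=
  v *m rG g^-1%g.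

Section Hom.

Variables (F : fieldType) (gT : finGroupType) (G : {group gT}).
Variables (n1 n2 : nat).
Variables (rG1 : mx_representation F G n1) (rG2 : mx_representation F G n2).

Definition hom_defect (B : 'M[F]_(n1, n2)) : {ffun subg_of G -> 'M[F]_(n1, n2)} :=
  [ffun x => rG1 (sgval x) *m B - B *m rG2 (sgval x)].

Lemma hom_defect_is_linear : linear hom_defect.
Proof.
move=> a B C; apply/ffunP=> x; rewrite !ffunE.
by rewrite mulmxDr mulmxDl -scalemxAr -scalemxAl scalerBr opprD addrACA.
Qed.

HB.instance Definition _ :=
  GRing.isLinear.Build F _ _ _ hom_defect hom_defect_is_linear.

Definition hom_space : {vspace 'M[F]_(n1, n2)} := lker (linfun hom_defect).

Lemma hom_spaceP (B : 'M[F]_(n1, n2)) :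
  reflect (forall x, x \in G -> rG1 x *m B = B *m rG2 x) (B \in hom_space).
Proof.
rewrite memv_ker lfunE /=; apply: (iffP eqP) => [/ffunP dB x Gx | homB].
  by have:= dB (subg G x); rewrite !ffunE subgK // => /eqP; rewrite subr_eq0 => /eqP.
by apply/ffunP=> x; rewrite !ffunE homB ?subrr ?subgP.
Qed.

Lemma hom_space_lactP (B : 'M[F]_(n1, n2)) :
  reflect (forall x v, x \in G -> lact rG1 x v *m B = lact rG2 x (v *m B))
          (B \in hom_space).
Proof.
apply: (iffP (hom_spaceP B)) => [homB x v Gx | homB x Gx].
  by rewrite /lact -!mulmxA homB ?groupV.
apply/row_matrixP=> i; rewrite !rowE !mulmxA.
by have:= homB x^-1%g (delta_mx 0 i); rewrite groupV /lact invgK => ->.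
Qed.

End Hom.

Section Induced.

Variables (F : fieldType) (gT : finGroupType) (G N : {group gT}) (n : nat).
Variable sigma : mx_representation F N n.

Definition ind_defect (f : {ffun subg_of G -> 'rV[F]_n}) :
    {ffun subg_of G * subg_of N -> 'rV[F]_n} :=
  [ffun gn : subg_of G * subg_of N =>
     let: g := gn.1 in let: y := sgval gn.2 in
     f (g * subg G y)%g - lact sigma y^-1%g (f g)].

Lemma ind_defect_is_linear : linear ind_defect.
Proof.
move=> a f h; apply/ffunP=> gn; rewrite !ffunE /= /lact.
by rewrite mulmxDl -scalemxAl scalerBr opprD addrACA.
Qed.

HB.instance Definition _ :=
  GRing.isLinear.Build F _ _ _ ind_defect ind_defect_is_linear.

Definition ind_space : {vspace {ffun subg_of G -> 'rV[F]_n}} :=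
  lker (linfun ind_defect).

Lemma ind_spaceP (f : {ffun subg_of G -> 'rV[F]_n}) :
  reflect (forall (g : subg_of G) (y : gT), y \in N ->
             f (g * subg G y)%g = lact sigma y^-1%g (f g))
          (f \in ind_space).
Proof.
rewrite memv_ker lfunE /=; apply: (iffP eqP) => [/ffunP df g y Ny | indf].
  have:= df (g, subg N y); rewrite !ffunE /= subgK // => /eqP.
  by rewrite subr_eq0 => /eqP.
by apply/ffunP=> -[g y]; rewrite !ffunE /= indf ?subrr ?subgP.
Qed.

Definition ind_act (g : gT) (f : {ffun subg_of G -> 'rV[F]_n}) :
    {ffun subg_of G -> 'rV[F]_n} :=
  [ffun x => f ((subg G g)^-1 * x)%g].

Lemma ind_act_is_linear g : linear (ind_act g).
Proof. by move=> a f h; apply/ffunP=> x; rewrite !ffunE. Qed.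

HB.instance Definition _ g :=
  GRing.isLinear.Build F _ _ _ (ind_act g) (ind_act_is_linear g).

Lemma ind_act_space g f : f \in ind_space -> ind_act g f \in ind_space.
Proof.
move/ind_spaceP=> indf; apply/ind_spaceP=> h y Ny.
by rewrite !ffunE mulgA indf.
Qed.

Lemma ind_act1 f : ind_act 1%g f = f.
Proof.
by apply/ffunP=> x; rewrite ffunE (morph1 (subg_morphism G)) invg1 mul1g.
Qed.

Lemma ind_actM g h f : g \in G -> h \in G ->
  ind_act (g * h)%g f = ind_act g (ind_act h f).
Proof.
move=> Gg Gh; apply/ffunP=> x; rewrite !ffunE.
by rewrite (morphM (subg_morphism G)) // invMg mulgA.
Qed.

Definition ind_coord (f : {ffun subg_of G -> 'rV[F]_n}) : 'rV[F]_(\dim ind_space) :=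
  \row_j coord (vbasis ind_space) j f.

(* The inverse makes lact of this matrix the left translation by g: see       *)
(* lact_ind below.                                                            *)
Definition ind_mx (g : gT) : 'M[F]_(\dim ind_space) :=
  \matrix_i ind_coord (ind_act g^-1%g (vbasis ind_space)`_i).

Lemma ind_mxE g f : f \in ind_space ->
  ind_coord f *m ind_mx g = ind_coord (ind_act g^-1%g f).
Proof.
move=> Uf; rewrite {2}(coord_vbasis Uf) linear_sum /=.
apply/rowP=> j; rewrite !mxE linear_sum /=; apply: eq_bigr => i _.
by rewrite !mxE !linearZ.
Qed.

Lemma ind_mx_repr : mx_repr G ind_mx.
Proof.
split=> [|g h Gg Gh]; apply/row_matrixP=> i; rewrite [LHS]rowK.
  rewrite invg1 ind_act1 row1; apply/rowP=> j; rewrite !mxE.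
  by rewrite coord_free ?(basis_free (vbasisP _)) // eqxx eq_sym.
rewrite row_mul rowK ind_mxE ?ind_act_space ?vbasis_mem ?mem_nth ?size_tuple //.
by rewrite invMg ind_actM ?groupV.
Qed.

(* Ind_N^G sigma, in coordinates with respect to a basis of ind_space. *)
Definition ind_repr : mx_representation F G (\dim ind_space) :=
  MxRepresentation ind_mx_repr.

Lemma lact_ind g f : f \in ind_space ->
  lact ind_repr g (ind_coord f) = ind_coord (ind_act g f).
Proof. by move=> Uf; rewrite /lact ind_mxE // invgK. Qed.

End Induced.

Section Conjugate.

Variables (F : fieldType) (gT : finGroupType) (N : {group gT}) (n : nat).
Variable sigma : mx_representation F N n.

(* y ^ g is g^-1 * y * g. As in cfConjg, the value for g outside 'N(N) is     *)
(* irrelevant: it only makes the definition total.                            *)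
Definition conj_mx (g y : gT) : 'M[F]_n :=
  sigma (if g \in 'N(N) then (y ^ g)%g else y).

Lemma conj_mx_repr g : mx_repr N (conj_mx g).
Proof.
rewrite /conj_mx; have [nNg | _] := boolP (g \in 'N(N)); split=> [|x y Nx Ny].
- by rewrite conj1g repr_mx1.
- by rewrite conjMg; apply: repr_mxM; rewrite memJ_norm.
- exact: repr_mx1.
exact: repr_mxM.
Qed.

Definition conj_repr (g : gT) : mx_representation F N n :=
  MxRepresentation (conj_mx_repr g).

Definition conj_sum (A : {set gT}) : representation F N :=
  \big[dadd_grepr/grepr0]_(t in A) Representation (conj_repr t).

Definition repr_inertia (G : {set gT}) : {set gT} :=
  [set g in G | `[< mx_rsim (conj_repr g) sigma >]].

Lemma conj_repr_rsimM g h : g \in 'N(N) -> h \in 'N(N) ->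
  mx_rsim (conj_repr g) sigma -> mx_rsim (conj_repr h) sigma ->
  mx_rsim (conj_repr (g * h)%g) sigma.
Proof.
move=> nNg nNh simg [B defn freeB homB]; apply: mx_rsim_trans simg.
exists B => // y Ny; have := homB (y ^ g)%g.
by rewrite /= /conj_mx (groupM nNg nNh) nNg nNh conjgM memJ_norm // => /(_ Ny).
Qed.

Lemma repr_inertia_group_set (G : {group gT}) :
  N <| G -> group_set (repr_inertia G).
Proof.
case/andP=> _ nNG; apply/group_setP; split=> [|g h].
  rewrite inE group1; apply/asboolP; exists 1%:M => //= [|y _].
    by rewrite row_free_unit unitmx1.
  by rewrite /conj_mx group1 conjg1 mulmx1 mul1mx.
rewrite !inE => /andP[Gg /asboolP simg] /andP[Gh /asboolP simh].
rewrite groupM //; apply/asboolP.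
by apply: conj_repr_rsimM; rewrite ?(subsetP nNG).
Qed.

Lemma sub_repr_inertia (G : {group gT}) : N <| G -> N \subset repr_inertia G.
Proof.
case/andP=> sNG nNG; apply/subsetP=> x Nx; rewrite inE (subsetP sNG) //=.
apply/asboolP; exists (sigma x^-1%g) => //= [|y Ny].
  by rewrite row_free_unit repr_mx_unit ?groupV.
rewrite /conj_mx (subsetP (normG N)) // conjgE -!repr_mxM ?groupM ?groupV //.
by rewrite -!mulgA mulgV mulg1.
Qed.

End Conjugate.

Definition is_subrepr (F : fieldType) (gT : finGroupType) (G : {group gT})
    (n1 n2 : nat) (rG1 : mx_representation F G n1)
    (rG2 : mx_representation F G n2) : Prop :=
  exists (U : 'M[F]_n2) (Umod : mxmodule rG2 U), mx_rsim rG1 (submod_repr Umod).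

(* Main.v *)
Require Import Defs.
From HB Require Import structures.
From mathcomp Require Import all_boot all_order all_algebra all_fingroup.
From mathcomp Require Import all_solvable all_field all_character.
From mathcomp Require Import boolp.

(**
  Frobenius reciprocity and Clifford theory for a normal subgroup. The
  restriction to N of Ind sigma, and that of an irreducible theta lying over
  sigma, are both direct sums of conjugates of sigma: the former by evaluating
  functions on the cosets tN, the latter by Clifford's theorem. Since the
  conjugates by x and y are equivalent iff x and y lie in the same left coset of
  the inertia group I, such a sum is determined by the number of summands whose
  index lies in rI, for r in R. This number is |I : N| for Ind sigma. For theta,
  Schur's lemma identifies it with dim Hom_N(^r sigma, theta), and this does not
  depend on r because theta(r) carries it to dim Hom_N(sigma, theta). Finally
  Hom_G(Ind sigma, Ind sigma) = Hom_N(Ind sigma, sigma), whose dimension is the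
  number of t in T with ^t sigma equivalent to sigma.
*)

Set Implicit Arguments.
Unset Strict Implicit.
Unset Printing Implicit Defensive.

Import GroupScope GRing.Theory.
Local Open Scope ring_scope.

(** * Direct sums of representations, up to equivalence *)

Section DirectSums.

Variables (F : fieldType) (gT : finGroupType) (G : {group gT}).

(** A two-sided inverse encodes both the equality of degrees and invertibility, so that block
    matrices can be checked by plain computation. *)
Lemma mx_rsimP n1 n2 (rG1 : mx_representation F G n1)
    (rG2 : mx_representation F G n2) :
  mx_rsim rG1 rG2 <->
  exists B C, [/\ B *m C = 1%:M, C *m B = 1%:M
    & forall x, x \in G -> rG1 x *m B = B *m rG2 x].
Proof.
split=> [[B def_n]|[B [C [BC CB homB]]]].
  case: n2 / def_n rG2 B => rG2 B; rewrite row_free_unit => uB homB.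
  by exists B, (invmx B); rewrite mulmxV ?mulVmx.
exists B => //; last by apply/row_freeP; exists C.
by apply/eqP; rewrite eqn_leq (mulmx1_min BC) (mulmx1_min CB).
Qed.

Lemma mx_rsim_dadd_congr (A1 A2 B1 B2 : representation F G) :
  mx_rsim A1 A2 -> mx_rsim B1 B2 ->
  mx_rsim (dadd_grepr A1 B1) (dadd_grepr A2 B2).
Proof.
move=> /mx_rsimP[X [X' [XX' X'X homX]]] /mx_rsimP[Y [Y' [YY' Y'Y homY]]].
apply/mx_rsimP; exists (block_mx X 0 0 Y), (block_mx X' 0 0 Y').
split=> [||x Gx]; rewrite /= !mulmx_block !(mulmx0, mul0mx, addr0, add0r).
- by rewrite XX' YY' -scalar_mx_block.
- by rewrite X'X Y'Y -scalar_mx_block.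
by rewrite homX ?homY.
Qed.

Lemma mx_rsim_daddC (A B : representation F G) :
  mx_rsim (dadd_grepr A B) (dadd_grepr B A).
Proof.
apply/mx_rsimP; exists (block_mx 0 1%:M 1%:M 0), (block_mx 0 1%:M 1%:M 0).
split=> [||x Gx]; rewrite /= !mulmx_block;
  by rewrite !(mulmx0, mul0mx, addr0, add0r, mulmx1, mul1mx) -?scalar_mx_block.
Qed.

Lemma mx_rsim_daddA (A B C : representation F G) :
  mx_rsim (dadd_grepr A (dadd_grepr B C)) (dadd_grepr (dadd_grepr A B) C).
Proof.
(* The intertwiner is the identity matrix, with only its columns cast along the associativity of the
   degrees. *)
pose c := (erefl (rdegree A + (rdegree B + rdegree C))%N,
           addnA (rdegree A) (rdegree B) (rdegree C)).
exists (castmx c 1%:M) => [||x Gx] /=; first exact: addnA.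
  by rewrite {}/c; case: _ / (addnA _ _ _); rewrite castmx_id /row_free mxrank1.
have := block_mxA (A11 := A x) (A12 := 0) (A13 := 0) (A21 := 0) (A22 := B x)
  (A23 := 0) (A31 := 0) (A32 := 0) (A33 := C x).
rewrite /= !row_mx0 !col_mx0 => ->; move: (block_mx _ 0 0 (C x)).
rewrite {}/c; case: _ / (addnA _ _ _) => Z.
by rewrite !castmx_id mulmx1 mul1mx.
Qed.

Lemma mx_rsim_dadd0 (A : representation F G) :
  mx_rsim (dadd_grepr grepr0 A) A.
Proof.
apply/mx_rsimP; exists (col_mx 0 1%:M), (row_mx 0 1%:M).
split=> [||x Gx] /=.
- rewrite mul_col_row !mulmx0 mul0mx mulmx1 [RHS](@scalar_mx_block _ 0).
  by congr block_mx; rewrite [RHS]flatmx0.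
- by rewrite mul_row_col mulmx0 mulmx1 add0r.
by rewrite mul_block_col mul_col_mx !mul0mx !mulmx0 mulmx1 mul1mx !add0r.
Qed.

Section Indexed.

Variables (I : Type) (U : I -> representation F G).
Local Notation dsum s := (\big[dadd_grepr/grepr0]_(i <- s) U i).

Lemma mx_rsim_dsum_cat (s1 s2 : seq I) :
  mx_rsim (dsum (s1 ++ s2)) (dadd_grepr (dsum s1) (dsum s2)).
Proof.
elim: s1 => [|i s1 IHs] /=.
  by rewrite big_nil; apply/mx_rsim_sym/mx_rsim_dadd0.
rewrite !big_cons; apply: mx_rsim_trans (mx_rsim_daddA _ _ _).
by apply: mx_rsim_dadd_congr IHs; apply: mx_rsim_refl.
Qed.

Lemma mx_rsim_dsum_flatten (s : seq I) k :
  mx_rsim (dsum (flatten (nseq k s))) (muln_grepr (dsum s) k).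
Proof.
rewrite /muln_grepr big_const_ord.
elim: k => [|k IHk] /=; first by rewrite big_nil; apply: mx_rsim_refl.
apply: mx_rsim_trans (mx_rsim_dsum_cat _ _) _.
by apply: mx_rsim_dadd_congr IHk; apply: mx_rsim_refl.
Qed.

End Indexed.

Lemma eq_mx_rsim_dsum (I : eqType) (U V : I -> representation F G) s :
    {in s, forall i, mx_rsim (U i) (V i)} ->
  mx_rsim (\big[dadd_grepr/grepr0]_(i <- s) U i)
          (\big[dadd_grepr/grepr0]_(i <- s) V i).
Proof.
elim: s => [|i s IHs] simUV; first by rewrite !big_nil; apply: mx_rsim_refl.
rewrite !big_cons; apply: mx_rsim_dadd_congr; first exact/simUV/mem_head.
by apply: IHs => j sj; apply: simUV; rewrite inE sj orbT.
Qed.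

(** By [catCA_perm_ind] it suffices to exchange the first two segments of a list, which is
    commutativity of [dadd_grepr]. *)
Lemma perm_mx_rsim_dsum (I : eqType) (U : I -> representation F G) s1 s2 :
    perm_eq s1 s2 ->
  mx_rsim (\big[dadd_grepr/grepr0]_(i <- s1) U i)
          (\big[dadd_grepr/grepr0]_(i <- s2) U i).
Proof.
pose P s := mx_rsim (\big[dadd_grepr/grepr0]_(i <- s1) U i)
                    (\big[dadd_grepr/grepr0]_(i <- s) U i).
move=> eq_s; apply: (@catCA_perm_ind _ P _ _ _ eq_s); last exact: mx_rsim_refl.
move=> s3 s4 s5 /mx_rsim_trans; apply; rewrite !catA.
apply: mx_rsim_trans (mx_rsim_dsum_cat _ _ _) _.
apply: mx_rsim_trans (mx_rsim_sym (mx_rsim_dsum_cat _ _ _)).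
apply: mx_rsim_dadd_congr (mx_rsim_refl _).
apply: mx_rsim_trans (mx_rsim_dsum_cat _ _ _) _.
apply: mx_rsim_trans (mx_rsim_sym (mx_rsim_dsum_cat _ _ _)).
exact: mx_rsim_daddC.
Qed.

(* The C i need not be morphisms: they only witness that the map with         *)
(* components B i is surjective.                                              *)
Lemma mx_rsim_dsum_split n (rG : mx_representation F G n) (I : eqType)
    (U : I -> representation F G) (s : seq I)
    (B : forall i, 'M[F]_(n, rdegree (U i)))
    (C : forall i, 'M[F]_(rdegree (U i), n)) :
    uniq s ->
    {in s, forall i x, x \in G -> rG x *m B i = B i *m U i x} ->
    {in s, forall i, C i *m B i = 1%:M} ->
    {in s &, forall i j, i != j -> C i *m B j = 0} ->
    (forall v : 'rV_n, {in s, forall i, v *m B i = 0} -> v = 0) ->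
  mx_rsim rG (\big[dadd_grepr/grepr0]_(i <- s) U i).
Proof.
move=> Us homB CB CB0 injB.
(* [X] is the row of all the [B i] and [Y] the column of all the [C i]. The last two clauses carry
   the induction: they make the off-diagonal blocks of the enlarged product [Y *m X] vanish. *)
suff [X [Y [homX YX injX _]]]: exists X Y,
    [/\ forall x, x \in G ->
          rG x *m X = X *m (\big[dadd_grepr/grepr0]_(i <- s) U i) x,
        Y *m X = 1%:M,
        forall v : 'rV_n, v *m X = 0 -> {in s, forall i, v *m B i = 0}
      & (forall k (Z : 'M_(k, n)), {in s, forall i, Z *m B i = 0} -> Z *m X = 0)
     /\ (forall k (Z : 'M_(n, k)), {in s, forall i, C i *m Z = 0} -> Y *m Z = 0)].
  (* As [Y *m X = 1%:M], each row of [X *m Y - 1%:M] is killed by [X], hence by every [B i], hence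
     is zero. *)
  apply/mx_rsimP; exists X, Y; split=> //; apply/eqP; rewrite -subr_eq0.
  apply/eqP/row_matrixP=> i; rewrite row0; apply/injB/injX.
  by rewrite -row_mul mulmxBl -mulmxA YX mulmx1 mul1mx subrr row0.
elim: s Us homB CB CB0 {injB} => [|i s IHs] /=.
  move=> _ _ _ _; rewrite big_nil; exists 0, 0.
  split=> [x _||//|]; first by rewrite mulmx0 mul0mx.
    by apply/matrixP=> [[]].
  by split=> k Z _; rewrite ?mulmx0 ?mul0mx.
case/andP=> si Us homB CB CB0; rewrite big_cons.
have sub j : j \in s -> j \in i :: s by rewrite inE orbC => ->.
have nij j : j \in s -> i != j by apply: contraTneq => <-.
have si' := mem_head i s.
have [j|j|j l|X [Y [homX YX injX [X0 Y0]]]] := IHs Us.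
- by move=> /sub; apply: homB.
- by move=> /sub; apply: CB.
- by move=> /sub sj /sub; apply: CB0.
exists (row_mx (B i) X), (col_mx (C i) Y); split.
- by move=> x Gx; rewrite mul_mx_row mul_row_block !mulmx0 addr0 add0r homX ?homB.
- rewrite mul_col_row YX CB // X0 ?Y0 -?scalar_mx_block // => j sj.
    by rewrite CB0 ?(sub _ sj) // eq_sym nij.
  by rewrite CB0 ?(sub _ sj) // nij.
- move=> v; rewrite mul_mx_row -(row_mx0 _ 1) => /eq_row_mx[vB vX] j.
  by rewrite inE => /predU1P[-> // | ]; apply: injX.
split=> k Z Z0.
  rewrite mul_mx_row Z0 // X0 ?row_mx0 // => j /sub; exact: Z0.
rewrite mul_col_mx Z0 // Y0 ?col_mx0 // => j /sub; exact: Z0.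
Qed.

End DirectSums.

(** * Dimensions of Hom spaces and Schur's lemma *)

Section HomDim.

Variable F : fieldType.

Lemma dimv_leq_inj (aT rT : vectType F) (f : {linear aT -> rT})
    (U : {vspace aT}) (V : {vspace rT}) :
    {in U, forall u, f u \in V} -> {in U, forall u, f u = 0 -> u = 0} ->
  (\dim U <= \dim V)%N.
Proof.
move=> fUV injf; rewrite -(limg_dim_eq (f := linfun f) (U := U)).
  by apply/dimvS/subvP=> _ /memv_imgP[u Uu ->]; rewrite lfunE; apply: fUV.
apply/eqP; rewrite -subv0; apply/subvP=> u /memv_capP[Uu].
by rewrite memv_ker lfunE memv0 => /eqP/(injf u Uu)/eqP.
Qed.

Variables (gT : finGroupType) (G : {group gT}).
Local Notation reprG := (mx_representation F G).

Lemma dim_hom_rsimr n n1 n2 (rG : reprG n) (rG1 : reprG n1) (rG2 : reprG n2) :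
  mx_rsim rG1 rG2 -> \dim (hom_space rG rG1) = \dim (hom_space rG rG2).
Proof.
move=> sim12; apply/eqP; rewrite eqn_leq.
wlog suff: n1 n2 rG1 rG2 sim12 /
    (\dim (hom_space rG rG1) <= \dim (hom_space rG rG2))%N.
  by move=> le; rewrite !le //; apply: mx_rsim_sym.
case/mx_rsimP: sim12 => B [C [BC _ homB]].
apply: (dimv_leq_inj (f := mulmxr B)) => /= X /hom_spaceP homX.
  by apply/hom_spaceP=> x Gx; rewrite mulmxA homX // -!mulmxA homB.
by move/(congr1 (mulmxr C)); rewrite /= -mulmxA BC mulmx1 mul0mx.
Qed.

Lemma dim_hom_rsiml n n1 n2 (rG : reprG n) (rG1 : reprG n1) (rG2 : reprG n2) :
  mx_rsim rG1 rG2 -> \dim (hom_space rG1 rG) = \dim (hom_space rG2 rG).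
Proof.
move=> sim12; apply/eqP; rewrite eqn_leq.
wlog suff: n1 n2 rG1 rG2 sim12 /
    (\dim (hom_space rG2 rG) <= \dim (hom_space rG1 rG))%N.
  by move=> le; rewrite !le //; apply: mx_rsim_sym.
case/mx_rsimP: sim12 => B [C [_ CB homB]].
apply: (dimv_leq_inj (f := mulmx B)) => /= X /hom_spaceP homX.
  by apply/hom_spaceP=> x Gx; rewrite mulmxA homB // -!mulmxA homX.
by move/(congr1 (mulmx C)); rewrite /= mulmxA CB mul1mx mulmx0.
Qed.

(** Rank-nullity for [f], which projects a morphism to its component in [B]: the kernel is a copy of
    the Hom space into [A], the image is the Hom space into [B]. *)
Lemma dim_hom_daddr n (rG : reprG n) (A B : representation F G) :
  \dim (hom_space rG (dadd_grepr A B)) =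
    (\dim (hom_space rG A) + \dim (hom_space rG B))%N.
Proof.
pose f := linfun (mulmxr (col_mx 0 1%:M : 'M[F]_(rdegree A + rdegree B, rdegree B))
          : 'M_(n, _) -> 'M_(n, _)).
have homP X Y : reflect (X \in hom_space rG A /\ Y \in hom_space rG B)
                  (row_mx X Y \in hom_space rG (dadd_grepr A B)).
  apply: (iffP (hom_spaceP _ _ _)) => [homXY|[/hom_spaceP homX /hom_spaceP homY] x Gx].
    split; apply/hom_spaceP=> x /homXY; rewrite /= mul_mx_row mul_row_block;
    by rewrite !mulmx0 addr0 add0r => /eq_row_mx[].
  by rewrite /= mul_mx_row mul_row_block !mulmx0 addr0 add0r homX ?homY.
have fE X Y : f (row_mx X Y) = Y.
  by rewrite lfunE /= mul_row_col mulmx0 mulmx1 add0r.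
rewrite -(limg_ker_dim f); congr (_ + _)%N; apply/eqP; rewrite eqn_leq.
  apply/andP; split.
    apply: (dimv_leq_inj (f := mulmxr (col_mx 1%:M 0))) => X /memv_capP[];
      rewrite -[X]hsubmxK memv_ker fE /= mul_row_col mulmx0 mulmx1 addr0.
      by case/homP.
    by move=> _ /eqP -> ->; rewrite row_mx0.
  apply: (dimv_leq_inj (f := mulmxr (row_mx 1%:M 0))) => X homX /=;
    rewrite mul_mx_row mulmx0 mulmx1.
    by rewrite memv_cap memv_ker fE eqxx andbT; apply/homP; rewrite mem0v.
  by rewrite -(row_mx0 _ n) => /eq_row_mx[].
apply/andP; split; apply: dimvS; apply/subvP=> X.
  by case/memv_imgP=> Y; rewrite -[Y]hsubmxK => /homP[_ ?] ->; rewrite fE.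
move=> homX; apply/memv_imgP; exists (row_mx 0 X); rewrite ?fE //.
by apply/homP; rewrite mem0v.
Qed.

(** Dual to [dim_hom_daddr]: here [f] restricts a morphism to the summand [B]. *)
Lemma dim_hom_daddl n (rG : reprG n) (A B : representation F G) :
  \dim (hom_space (dadd_grepr A B) rG) =
    (\dim (hom_space A rG) + \dim (hom_space B rG))%N.
Proof.
pose f := linfun (mulmx (row_mx 0 1%:M : 'M[F]_(rdegree B, rdegree A + rdegree B))
          : 'M_(_, n) -> 'M_(_, n)).
have homP X Y : reflect (X \in hom_space A rG /\ Y \in hom_space B rG)
                  (col_mx X Y \in hom_space (dadd_grepr A B) rG).
  apply: (iffP (hom_spaceP _ _ _)) => [homXY|[/hom_spaceP homX /hom_spaceP homY] x Gx].
    split; apply/hom_spaceP=> x /homXY; rewrite /= mul_block_col mul_col_mx;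
    by rewrite !mul0mx addr0 add0r => /eq_col_mx[].
  by rewrite /= mul_block_col mul_col_mx !mul0mx addr0 add0r homX ?homY.
have fE X Y : f (col_mx X Y) = Y.
  by rewrite lfunE /= mul_row_col mul0mx mul1mx add0r.
rewrite -(limg_ker_dim f); congr (_ + _)%N; apply/eqP; rewrite eqn_leq.
  apply/andP; split.
    apply: (dimv_leq_inj (f := mulmx (row_mx 1%:M 0))) => X /memv_capP[];
      rewrite -[X]vsubmxK memv_ker fE /= mul_row_col mul0mx mul1mx addr0.
      by case/homP.
    by move=> _ /eqP -> ->; rewrite col_mx0.
  apply: (dimv_leq_inj (f := mulmx (col_mx 1%:M 0))) => X homX /=;
    rewrite mul_col_mx mul0mx mul1mx.
    by rewrite memv_cap memv_ker fE eqxx andbT; apply/homP; rewrite mem0v.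
  by move/(congr1 usubmx); rewrite col_mxKu linear0.
apply/andP; split; apply: dimvS; apply/subvP=> X.
  by case/memv_imgP=> Y; rewrite -[Y]vsubmxK => /homP[_ ?] ->; rewrite fE.
move=> homX; apply/memv_imgP; exists (col_mx 0 X); rewrite ?fE //.
by apply/homP; rewrite mem0v.
Qed.

(** Schur's lemma: the kernel and the row space of [B] are submodules, so the first is zero and the
    second is everything. *)
Lemma mx_irr_hom_rsim n1 n2 (rG1 : reprG n1) (rG2 : reprG n2) B :
    mx_irreducible rG1 -> mx_irreducible rG2 ->
    B \in hom_space rG1 rG2 -> B != 0 ->
  mx_rsim rG1 rG2.
Proof.
move=> irr1 irr2 /hom_spaceP homB nzB.
have freeB: row_free B.
  rewrite -kermx_eq0; apply: contraNT nzB => nzK.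
  have [_ /(_ (kermx B)) fullK] := (mx_irrP _).1 irr1.
  have /row_fullP[C CK]: row_full (kermx B).
    apply: fullK => //; apply/mxmoduleP=> x Gx; apply/sub_kermxP.
    by rewrite -mulmxA homB // mulmxA mulmx_ker mul0mx.
  by rewrite -[B]mul1mx -CK -mulmxA mulmx_ker mulmx0.
have fullB: row_full B.
  case/mx_irrP: irr2 => _ /(_ <<B>>%MS).
  rewrite -sub1mx !genmxE sub1mx; apply; last by rewrite -submx0 genmxE submx0.
  apply/mxmoduleP=> x Gx; rewrite genmxE (eqmxMr _ (genmxE _)) -homB //.
  exact: submxMl.
have /row_freeP[C BC] := freeB; have /row_fullP[D DB] := fullB.
apply/mx_rsimP; exists B, C; split=> //.
by rewrite -[C]mul1mx -DB -(mulmxA D) BC mulmx1 DB.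
Qed.

(** Absolute irreducibility makes the endomorphisms of [rG1] scalar, so the dimension is exactly 1
    when the two are equivalent. *)
Lemma dim_hom_abs_irr n1 n2 (rG1 : reprG n1) (rG2 : reprG n2) :
    mx_absolutely_irreducible rG1 -> mx_absolutely_irreducible rG2 ->
  \dim (hom_space rG1 rG2) = `[< mx_rsim rG1 rG2 >].
Proof.
move=> abs1 abs2; have [irr1 irr2] := (mx_abs_irrW abs1, mx_abs_irrW abs2).
case: asboolP => [sim12|not12]; last first.
  apply/eqP; rewrite dimv_eq0 -subv0; apply/subvP=> B homB; rewrite memv0.
  apply: contra_notT not12 => nzB; exact: mx_irr_hom_rsim nzB.
rewrite -(dim_hom_rsimr _ sim12).
rewrite (_ : hom_space _ _ = <[1%:M]>%VS).
  (* The degree must be positive for the identity matrix to be nonzero and span a line. *)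
  rewrite dim_vline; have [n1_gt0 _] := mx_abs_irrP abs1.
  by rewrite -mxrank_eq0 mxrank1 -lt0n n1_gt0.
apply/eqP; rewrite eqEsubv; apply/andP; split; apply/subvP=> B; last first.
  case/vlineP=> a ->; apply/hom_spaceP=> x _.
  by rewrite -scalemxAl -scalemxAr mul1mx mulmx1.
move/hom_spaceP=> homB; have /is_scalar_mxP[a ->]: is_scalar_mx B.
  by apply: (mx_abs_irr_cent_scalar abs1); apply/centgmxP=> x Gx; rewrite homB.
by apply/vlineP; exists a; rewrite scalemx1.
Qed.

Variables (I : Type) (U : I -> representation F G) (n : nat) (rG : reprG n).
Hypothesis absU : forall i, mx_absolutely_irreducible (U i).
Hypothesis absG : mx_absolutely_irreducible rG.

Lemma dim_hom_dsumr s :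
  \dim (hom_space rG (\big[dadd_grepr/grepr0]_(i <- s) U i)) =
    count (fun i => `[< mx_rsim rG (U i) >]) s.
Proof.
elim: s => [|i s IHs]; last first.
  by rewrite big_cons dim_hom_daddr /= IHs dim_hom_abs_irr.
rewrite big_nil; apply/eqP; rewrite -leqn0 (leq_trans (dimvS (subvf _))) //.
by rewrite dimvf /dim /= muln0.
Qed.

Lemma dim_hom_dsuml s :
  \dim (hom_space (\big[dadd_grepr/grepr0]_(i <- s) U i) rG) =
    count (fun i => `[< mx_rsim (U i) rG >]) s.
Proof.
elim: s => [|i s IHs]; last first.
  by rewrite big_cons dim_hom_daddl /= IHs dim_hom_abs_irr.
rewrite big_nil; apply/eqP; rewrite -leqn0 (leq_trans (dimvS (subvf _))) //.
by rewrite dimvf /dim /= mul0n.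
Qed.

End HomDim.

(** * Left transversals in a tower of subgroups *)

Section LeftTransversal.

Variable gT : finGroupType.
Implicit Types (G H K : {group gT}) (R Q X : {set gT}).

Lemma lcosets_partition G H : H \subset G -> partition (lcosets H G) G.
Proof.
move=> sHG; apply/and3P; split.
- apply/eqP/setP=> x; apply/bigcupP/idP=> [[_ /lcosetsP[y Gy ->]] | Gx].
    by case/lcosetP=> h /(subsetP sHG) Gh ->; apply: groupM.
  by exists (x *: H)%g; [apply/lcosetsP; exists x | apply: lcoset_refl].
- apply/trivIsetP=> _ _ /lcosetsP[x _ ->] /lcosetsP[y _ ->].
  apply: contraR => /pred0Pn[z /andP[/= xHz yHz]].
  by rewrite -(lcoset_eqP xHz) -(lcoset_eqP yHz).
by apply/lcosetsP=> [[x _ /setP/(_ x)]]; rewrite lcoset_refl inE.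
Qed.

(** Unfolds the partition-based notion into existence and uniqueness of representatives, with
    [r^-1 * x \in H] standing for equality of the left cosets of [r] and [x]. *)
Lemma lcosets_transversalP G H X : H \subset G ->
  reflect [/\ X \subset G,
              {in G, forall x, exists2 r, r \in X & r^-1 * x \in H}
            & {in X &, forall r s, r^-1 * s \in H -> r = s}]%g
          (is_transversal X (lcosets H G) G).
Proof.
move=> sHG; apply: (iffP and3P) => [[_ sXG /forall_inP trX]|[sXG exX injX]].
  have tr1 x : x \in G -> exists r, X :&: (x *: H)%g = [set r].
    by move=> Gx; apply/cards1P/trX/lcosetsP; exists x.
  split=> // [x Gx|r s Xr Xs rHs].
    have [r /setP/(_ r)] := tr1 x Gx; rewrite !inE eqxx => /andP[Xr xHr].
    by exists r => //; rewrite -mem_lcoset lcoset_sym.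
  have [t /setP Dt] := tr1 r (subsetP sXG r Xr).
  have := Dt s; have := Dt r; rewrite !inE lcoset_refl Xr Xs mem_lcoset rHs /=.
  by move=> /esym/eqP-> /esym/eqP->.
split=> //; first exact: lcosets_partition.
apply/forall_inP=> _ /lcosetsP[x Gx ->]; apply/cards1P.
have [r Xr rHx] := exX x Gx; exists r; apply/setP=> s; rewrite !inE.
apply/andP/eqP=> [[Xs xHs]|->]; last by rewrite lcoset_sym mem_lcoset.
by apply/esym/injX; rewrite // -(mulKVg x s) mulgA groupM // -mem_lcoset.
Qed.

Lemma lcosets_transversalM G H K R Q :
    H \subset K -> K \subset G ->
    is_transversal R (lcosets K G) G -> is_transversal Q (lcosets H K) K ->
  is_transversal (R * Q)%g (lcosets H G) G.
Proof.
move=> sHK sKG /(lcosets_transversalP _ sKG)[sRG exR injR].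
case/(lcosets_transversalP _ sHK)=> sQK exQ injQ.
apply/(lcosets_transversalP _ (subset_trans sHK sKG)).
split=> [|x Gx|_ _ /mulsgP[r q Rr Qq ->] /mulsgP[s t Rs Qt ->]].
- by rewrite mul_subG // (subset_trans sQK).
- have [r Rr /exQ[q Qq qHx]] := exR x Gx.
  by exists (r * q)%g; rewrite ?mem_mulg // invMg -mulgA.
rewrite invMg -!mulgA => Hqt.
have [Kq Kt] := (subsetP sQK q Qq, subsetP sQK t Qt).
(* Membership in [H] is weakened to membership in [K], where [q] and [t] cancel; they can be
   compared in [H] only once [r = s]. *)
have Drs : r = s.
  apply: injR => //; rewrite -(groupMl _ (groupVr Kq)) -(groupMr _ Kt) -!mulgA.
  exact: (subsetP sHK).
by rewrite Drs mulKg in Hqt *; rewrite (injQ q t).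
Qed.

(** Uniqueness of representatives in [R] shows that the elements counted are exactly those of the
    translate of [Q] by [r]. *)
Lemma card_lcosets_transversalM G H K R Q r :
    H \subset K -> K \subset G ->
    is_transversal R (lcosets K G) G -> is_transversal Q (lcosets H K) K ->
  r \in R -> #|[set t in R * Q | r^-1 * t \in K]%g| = #|K : H|%g.
Proof.
move=> sHK sKG /(lcosets_transversalP _ sKG)[sRG exR injR] trQ Rr.
rewrite -card_lcosets -(card_transversal trQ) -(card_lcoset Q r).
have [sQK _ _] := lcosets_transversalP _ sHK trQ.
apply: eq_card => t; rewrite inE; apply/andP/lcosetP => [[]|[q Qq ->]].
  case/mulsgP=> s q Rs Qq -> Krsq; exists q => //; congr (_ * _)%g.
  apply/esym/injR => //; rewrite -(groupMr _ (subsetP sQK q Qq)) -mulgA //.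
by rewrite mem_mulg // mulKg (subsetP sQK).
Qed.

End LeftTransversal.

(** * Conjugates of [sigma] and cosets of the inertia group *)

Section Conjugates.

Variables (F : fieldType) (gT : finGroupType) (G N : {group gT}).
Hypothesis nsNG : N <| G.
Variables (n : nat) (sigma : mx_representation F N n).

Let nNG : G \subset 'N(N) := normal_norm nsNG.
Local Notation conj g := (conj_repr sigma g).
Local Notation crepr := (fun g => Representation (conj_repr sigma g)).

(** A conjugate consists of the same matrices as [sigma], permuted, so it has the same submodules;
    for [g] outside the normalizer it is [sigma] itself. *)
Lemma mx_irr_conj g : mx_irreducible sigma -> mx_irreducible (conj g).
Proof.
move/mx_irrP=> [n_gt0 irr]; apply/mx_irrP; split=> // U /mxmoduleP modU.
apply: irr; apply/mxmoduleP=> y Ny.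
have [nNg|nNg] := boolP (g \in 'N(N)).
  have := modU (y ^ g^-1)%g; rewrite /= /conj_mx nNg conjgKV.
  by apply; rewrite memJ_norm ?groupV.
by have := modU y Ny; rewrite /= /conj_mx (negPf nNg).
Qed.

Lemma conj_repr1 : mx_rsim (conj 1%g) sigma.
Proof.
apply/mx_rsimP; exists 1%:M, 1%:M; split=> [||x Nx]; rewrite ?mulmx1 //.
by rewrite mul1mx /= /conj_mx group1 conjg1.
Qed.

(** The same matrix intertwines both pairs: the condition at [z] for the translated pair is the
    condition at [z ^ g] for the original one. *)
Lemma conj_repr_rsimMl g x y : g \in G -> x \in G -> y \in G ->
  mx_rsim (conj x) (conj y) -> mx_rsim (conj (g * x)%g) (conj (g * y)%g).
Proof.
move=> /(subsetP nNG) nNg /(subsetP nNG) nNx /(subsetP nNG) nNy.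
case=> B defn freeB homB; exists B => // z Nz; have := homB (z ^ g)%g.
by rewrite /= /conj_mx memJ_norm // nNx nNy !groupM // !conjgM; apply.
Qed.

(** Translation by [y^-1] reduces the question to a comparison with [sigma]. Thus classes of
    conjugates correspond to left cosets of the inertia group. *)
Lemma conj_repr_rsimE x y : x \in G -> y \in G ->
  `[< mx_rsim (conj x) (conj y) >] = (y^-1 * x \in repr_inertia sigma G)%g.
Proof.
move=> Gx Gy; rewrite inE groupM ?groupV //=; apply/asboolP/asboolP.
  move/(conj_repr_rsimMl (groupVr Gy) Gx Gy); rewrite mulVg => simxy.
  exact: mx_rsim_trans simxy conj_repr1.
move=> simyx; have := mx_rsim_trans simyx (mx_rsim_sym conj_repr1).
move/(conj_repr_rsimMl Gy (groupM (groupVr Gy) Gx) (group1 G)).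
by rewrite mulKVg mulg1.
Qed.

(** Each conjugate is replaced by the equivalent one at the representative of its coset; the list so
    obtained is a permutation of [k] copies of [R]. *)
Lemma dsum_conj_muln (I : {group gT}) (R : {set gT}) (s : seq gT) k :
    repr_inertia sigma G = I -> is_transversal R (lcosets I G) G ->
    {subset s <= G} ->
    {in R, forall r, count (fun x => r^-1 * x \in I)%g s = k} ->
  mx_rsim (\big[dadd_grepr/grepr0]_(x <- s) crepr x)
          (muln_grepr (conj_sum sigma R) k).
Proof.
move=> defI trR sG countR.
have sIG: I \subset G by rewrite -defI; apply/subsetP=> x; rewrite inE => /andP[].
have [sRG exR injR] := lcosets_transversalP _ sIG trR.
(* The default [1] is never taken on [G], where every element has a representative in [R]. *)
pose rep x := odflt 1%g [pick r in R | r^-1 * x \in I]%g.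
have repP x : x \in G -> rep x \in R /\ ((rep x)^-1 * x \in I)%g.
  move=> Gx; rewrite /rep; case: pickP => [r /andP[]//|].
  by have [r Rr Ix] := exR x Gx => /(_ r); rewrite Rr Ix.
apply: mx_rsim_trans (eq_mx_rsim_dsum (V := crepr \o rep) _) _.
  move=> x /sG Gx; have [/(subsetP sRG) Grx Ix] := repP x Gx.
  by apply/asboolP; rewrite conj_repr_rsimE // defI.
have := big_map rep xpredT crepr (r := s) (op := dadd_grepr) (idx := grepr0).
move=> /= <-; rewrite /conj_sum -(big_filter _ [in R]).
apply: mx_rsim_trans (mx_rsim_dsum_flatten (fun g => Representation (conj g)) _ k).
apply: perm_mx_rsim_dsum.
(* The permutation is checked by counting occurrences: [k] for an element of [R], none for any
   other. *)
apply/allP=> r _ /=; apply/eqP; rewrite count_flatten map_nseq sumn_nseq.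
rewrite [in RHS]count_uniq_mem ?filter_uniq ?index_enum_uniq // mem_filter.
rewrite mem_index_enum andbT count_map; have [Rr|R'r] /= := boolP (r \in R).
  rewrite mul1n -(countR r Rr); apply: eq_in_count => x /sG Gx /=.
  have [Rrx Ix] := repP x Gx; apply/eqP/idP=> [<- //|Irx].
  by apply: injR => //; rewrite -(groupMr _ Irx) -mulgA mulKVg.
rewrite mul0n; apply/eqP; rewrite -leqn0 leqNgt -has_count.
apply/hasPn=> x /sG Gx /=; apply: contraNneq R'r => <-.
by case: (repP x Gx).
Qed.

End Conjugates.

(** The intertwiner is [A] read in the coordinates of [W]; its right inverse first returns to the
    ambient space by [val_submod]. *)
Lemma mx_rsim_submod_hom (F : fieldType) (gT : finGroupType) (G : {group gT})
    n1 n2 (rG1 : mx_representation F G n1) (rG2 : mx_representation F G n2)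
    (A : 'M_(n1, n2)) (W : 'M_n2) (modW : mxmodule rG2 W) :
    row_free A -> (A :=: W)%MS ->
    (forall x, x \in G -> rG1 x *m A = A *m rG2 x) ->
  mx_rsim rG1 (submod_repr modW).
Proof.
move=> freeA defW homA; exists (in_submod W A) => [||x Gx].
- by rewrite -defW (eqP freeA).
- have /row_freeP[C AC] := freeA; apply/row_freeP.
  exists (val_submod 1%:M *m C).
  by rewrite mulmxA -val_submodE in_submodK ?defW.
rewrite -in_submodJ ?defW // -homA //.
by rewrite [RHS]in_submodE -mulmxA -in_submodE.
Qed.

(** * Clifford's theorem for the restriction of [theta] *)

Section Clifford.

Variables (F : fieldType) (gT : finGroupType) (G N : {group gT}).
Hypothesis nsNG : N <| G.
Variables (n : nat) (sigma : mx_representation F N n).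
Variables (m : nat) (theta : mx_representation F G m).
Local Notation thetaN := (subg_repr theta (normal_sub nsNG)).

(** Right multiplication by the invertible [theta g] turns morphisms from the conjugate into
    morphisms from [sigma], because [theta (y ^ g^-1) *m theta g = theta g *m theta y]; [theta g^-1]
    goes back. *)
Lemma dim_hom_conj g : g \in G ->
  \dim (hom_space (conj_repr sigma g) thetaN) = \dim (hom_space sigma thetaN).
Proof.
move=> Gg; have nNg := subsetP (normal_norm nsNG) g Gg.
have sNG := subsetP (normal_sub nsNG).
apply/eqP; rewrite eqn_leq; apply/andP; split.
  apply: (dimv_leq_inj (f := mulmxr (theta g))) => /= X /hom_spaceP homX.
    apply/hom_spaceP=> y Ny; have Gy := sNG y Ny.
    have := homX (y ^ g^-1)%g; rewrite /= /conj_mx nNg conjgKV mulmxA.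
    rewrite memJ_norm ?groupV // => ->; last by [].
    rewrite -!mulmxA -!repr_mxM ?groupJ ?groupV //.
    by rewrite conjgE invgK -mulgA mulgKV.
  move/(congr1 (mulmxr (theta g^-1%g))).
  by rewrite /= -mulmxA -repr_mxM ?groupV // mulgV repr_mx1 mulmx1 mul0mx.
apply: (dimv_leq_inj (f := mulmxr (theta g^-1%g))) => /= X /hom_spaceP homX.
  apply/hom_spaceP=> y Ny; have Gy := sNG y Ny.
  have := homX (y ^ g)%g; rewrite /= /conj_mx nNg mulmxA.
  rewrite memJ_norm // => ->; last by [].
  rewrite -!mulmxA -!repr_mxM ?groupJ ?groupV //.
  by rewrite conjgE -mulgA mulgK.
move/(congr1 (mulmxr (theta g))).
by rewrite /= -mulmxA -repr_mxM ?groupV // mulVg repr_mx1 mulmx1 mul0mx.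
Qed.

(** [Clifford_basis] writes the space of [theta] as a direct sum of translates of a copy [U] of
    [sigma]. As the action is on the right, [U *m theta x] affords the conjugate by [x^-1]. *)
Lemma Clifford_conj_dsum :
    mx_irreducible sigma -> mx_irreducible theta -> is_subrepr sigma thetaN ->
  exists2 s : seq gT, {subset s <= G} &
    mx_rsim thetaN
      (\big[dadd_grepr/grepr0]_(x <- s) Representation (conj_repr sigma x)).
Proof.
move=> irr_sigma irr_theta [U [modU simU]].
have simpleU : mxsimple thetaN U by apply/submod_mx_irr/mx_rsim_irr/irr_sigma/simU.
have [X sXG /= [defX dxX]] := Clifford_basis irr_theta simpleU.
(* [A] is the equivalence of [sigma] with [U], seen as a map into the whole space of [theta]. *)
have [A [freeA defA homA]] : exists A : 'M_(n, m),
    [/\ row_free A, (A :=: U)%MS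
      & forall y, y \in N -> sigma y *m A = A *m theta y].
  case: simU => B def_n freeB homB; exists (val_submod B).
  have rankB : \rank (val_submod B) = n.
    by rewrite val_submodE mxrankMfree ?(eqP freeB) // /row_free val_submod1.
  split=> [||y Ny]; first by rewrite /row_free rankB.
    by apply/eqmxP; rewrite -(geq_leqif (mxrank_leqif_eq (val_submodP _))) rankB def_n.
  rewrite -(val_submodJ modU) // -homB //.
  by rewrite [RHS]val_submodE -mulmxA -val_submodE.
(* [mx_rsim_dsum] wants a module for every element of [gT], so elements outside [G] are sent to [1];
   nothing changes on [X]. *)
pose g x := if x \in G then x else 1%g.
have Gg x : g x \in G by rewrite /g; case: ifP.
have modUg x : mxmodule thetaN (U *m theta (g x)).
  by have [] := Clifford_simple simpleU (Gg x).
exists [seq (g x)^-1%g | x <- index_enum gT & x \in X].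
  by move=> _ /mapP[x _ ->]; rewrite groupV.
have eq_g x : x \in X -> U *m theta x = U *m theta (g x).
  by move=> Xx; rewrite /g (subsetP sXG).
have simUg x : mx_rsim (submod_repr (modUg x))
                       (Representation (conj_repr sigma (g x)^-1%g)).
  apply/mx_rsim_sym/(mx_rsim_submod_hom (A := A *m theta (g x))).
  - by rewrite /row_free mxrankMfree // row_free_unit repr_mx_unit.
  - exact: eqmxMr.
  move=> y Ny; have Gy := subsetP (normal_sub nsNG) y Ny.
  have nNg : (g x)^-1%g \in 'N(N) by rewrite groupV (subsetP (normal_norm nsNG)).
  have NyJ : (y ^ (g x)^-1)%g \in N by rewrite memJ_norm.
  rewrite /= /conj_mx nNg mulmxA homA // -!mulmxA -!repr_mxM ?groupJ ?groupV //.
  by rewrite conjgE invgK -mulgA mulgKV.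
rewrite big_map big_filter.
have eqS : (\sum_(x in X) U *m theta x = \sum_(x in X) U *m theta (g x))%MS.
  exact: eq_bigr.
have eq_rank : (\sum_(x in X) \rank (U *m theta x)
                = \sum_(x in X) \rank (U *m theta (g x)))%N.
  by apply: eq_bigr => x /eq_g->.
rewrite eqS in defX; rewrite mxdirectE /= eqS eq_rank in dxX.
apply: mx_rsim_trans (mx_rsim_sym (rsim_submod1 (mxmodule1 thetaN) _)) _ => //.
by apply: (mx_rsim_dsum _ defX _ simUg); rewrite mxdirectE.
Qed.

End Clifford.

(** * Evaluation maps on the induced representation *)

Section Induction.

Variables (F : fieldType) (gT : finGroupType) (G N : {group gT}).
Hypothesis nsNG : N <| G.
Variables (n : nat) (sigma : mx_representation F N n).

Local Notation ind := (ind_repr G sigma).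
Local Notation indN := (subg_repr ind (normal_sub nsNG)).
Local Notation V := (ind_space G sigma).

Lemma ind_coord_surj (v : 'rV[F]_(\dim V)) :
  exists2 f, f \in V & v = ind_coord sigma f.
Proof.
exists (\sum_j v 0 j *: (vbasis V)`_j).
  by apply: memv_suml => j _; rewrite memvZ ?vbasis_mem ?mem_nth ?size_tuple.
by apply/rowP=> j; rewrite mxE coord_sum_free ?(basis_free (vbasisP _)).
Qed.

Definition ind_eval (g : subg_of G) : 'M[F]_(\dim V, n) :=
  \matrix_j (vbasis V)`_j g.

Lemma ind_evalE g f : f \in V -> ind_coord sigma f *m ind_eval g = f g.
Proof.
move=> Vf; rewrite {2}(coord_vbasis Vf) sum_ffunE mulmx_sum_row.
by apply: eq_bigr => j _; rewrite rowK !mxE ffunE.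
Qed.

Lemma ind_eval_inj (v : 'rV_(\dim V)) :
  (forall g, v *m ind_eval g = 0) -> v = 0.
Proof.
have [f Vf ->] := ind_coord_surj v => f0.
have ->: f = 0 by apply/ffunP=> g; rewrite -ind_evalE // f0 ffunE.
by apply/rowP=> j; rewrite !mxE linear0.
Qed.

(** The product is [h * g], without an inverse, because on row vectors [ind h] is left translation
    by [h^-1]. *)
Lemma ind_mx_eval h g : h \in G ->
  ind h *m ind_eval g = ind_eval (subg G h * g)%g.
Proof.
move=> Gh; apply/row_matrixP=> j; rewrite row_mul !rowK ind_evalE; last first.
  by rewrite ind_act_space ?vbasis_mem ?mem_nth ?size_tuple.
rewrite ffunE; congr (_ (_ * _)%g).
by apply: val_inj; rewrite /= !subgK ?groupV // invgK.
Qed.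

Lemma ind_evalM g y : y \in N ->
  ind_eval (g * subg G y)%g = ind_eval g *m sigma y.
Proof.
move=> Ny; apply/row_matrixP=> j; rewrite row_mul !rowK.
have /ind_spaceP-> // : (vbasis V)`_j \in V.
  by rewrite vbasis_mem ?mem_nth ?size_tuple.
by rewrite /lact invgK.
Qed.

(** Frobenius reciprocity, by evaluation at [1]: this is injective since equivariance recovers the
    value at any [g] from the value at [1]. *)
Lemma dim_hom_ind m (rG : mx_representation F G m) :
  \dim (hom_space rG ind) =
  \dim (hom_space (subg_repr rG (normal_sub nsNG)) sigma).
Proof.
have sNG := subsetP (normal_sub nsNG).
pose ev1 : 'M_(m, \dim V) -> 'M_(m, n) := mulmxr (ind_eval 1%g).
have homE X h g : X \in hom_space rG ind -> h \in G ->
    X *m ind_eval (subg G h * g)%g = rG h *m X *m ind_eval g.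
  by move=> /hom_spaceP homX Gh; rewrite homX // -mulmxA ind_mx_eval.
apply/eqP; rewrite eqn_leq; apply/andP; split.
  apply: (dimv_leq_inj (f := mulmxr (ind_eval 1%g))) => /= X homX.
    apply/hom_spaceP=> y Ny /=; rewrite mulmxA -homE ?sNG // mulg1.
    by rewrite -[subg G y]mul1g ind_evalM // mulmxA.
  move=> X1; apply/row_matrixP=> i; rewrite row0; apply: ind_eval_inj => g.
  rewrite -row_mul -[g]mulg1 -[g]sgvalK homE ?subgP //.
  by rewrite -mulmxA X1 mulmx0 row0.
(* An image has at most the dimension of its source, so it remains to lift each [X] to a morphism
   [Y] with value [X] at [1]. *)
apply: (@leq_trans (\dim (linfun ev1 @: hom_space rG ind)%VS)); last first.
  by rewrite -(limg_ker_dim (linfun ev1) (hom_space rG ind)) leq_addl.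
apply/dimvS/subvP=> X /hom_spaceP homX.
(* [f i] is the image of the [i]-th basis vector under the lift; equivariance forces its values. *)
pose f i := [ffun g : subg_of G => row i (rG (sgval g) *m X)].
have Vf i : f i \in V.
  apply/ind_spaceP=> g y Ny; rewrite !ffunE /lact invgK -row_mul -mulmxA.
  have Gy := sNG y Ny; have Gg := subgP g.
  rewrite -homX // mulmxA -repr_mxM //.
  by rewrite /= subgK.
pose Y : 'M_(m, \dim V) := \matrix_i ind_coord sigma (f i).
have YE g : Y *m ind_eval g = rG (sgval g) *m X.
  by apply/row_matrixP=> i; rewrite row_mul rowK ind_evalE // ffunE.
apply/memv_imgP; exists Y; last by rewrite lfunE /ev1 /= YE repr_mx1 mul1mx.
apply/hom_spaceP=> h Gh; apply/row_matrixP=> i; apply/eqP; rewrite -subr_eq0.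
apply/eqP; rewrite -linearB; apply: ind_eval_inj => g.
rewrite -row_mul mulmxBl -!mulmxA ind_mx_eval // !YE /= subgK //.
by rewrite repr_mxM ?subgP // mulmxA subrr row0.
Qed.

(** Evaluation at [t] is an [N]-morphism to the conjugate by [t], since [y * t = t * y ^ t], and the
    values on [T] determine a function of [V]. *)
Lemma mx_rsim_ind_conj_sum T : is_transversal T (lcosets N G) G ->
  mx_rsim indN (conj_sum sigma T).
Proof.
have sNG := normal_sub nsNG; case/(lcosets_transversalP _ sNG)=> sTG exT injT.
(* [e t i] is supported on the coset of [t] and takes the [i]-th basis vector as its value at [t];
   these functions form the section [C t] of evaluation at [t]. *)
pose e t i := [ffun g : subg_of G => if (t^-1 * sgval g)%g \in N
                 then row i (sigma (t^-1 * sgval g)%g) else 0].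
have Ve t i : e t i \in V.
  apply/ind_spaceP=> g y Ny; rewrite !ffunE /lact invgK /= subgK ?(subsetP sNG) //.
  rewrite mulgA groupMr //; case: ifP => [Ntg|_]; last by rewrite mul0mx.
  by rewrite repr_mxM // row_mul.
pose C t : 'M_(n, \dim V) := \matrix_i ind_coord sigma (e t i).
have CE t g : C t *m ind_eval g =
    if (t^-1 * sgval g)%g \in N then sigma (t^-1 * sgval g)%g else 0.
  apply/row_matrixP=> i; rewrite row_mul rowK ind_evalE // ffunE.
  by case: ifP => // _; rewrite row0.
rewrite /conj_sum -(big_filter _ [in T]).
have memT t : t \in [seq x <- index_enum gT | x \in T] -> t \in T.
  by rewrite mem_filter => /andP[].
apply: (mx_rsim_dsum_split (U := fun t => Representation (conj_repr sigma t))
          (B := fun t => ind_eval (subg G t)) (C := C)) => /=.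
- by rewrite filter_uniq ?index_enum_uniq.
- move=> t /memT/(subsetP sTG) Gt y Ny; have Gy := subsetP sNG y Ny.
  have nNt := subsetP (normal_norm nsNG) t Gt.
  rewrite ind_mx_eval // /conj_mx nNt -ind_evalM ?memJ_norm //.
  congr ind_eval; apply: val_inj; rewrite /= !subgK ?groupJ //.
  by rewrite conjgE !mulgA mulgV mul1g.
- move=> t /memT/(subsetP sTG) Gt.
  by rewrite CE subgK // mulVg group1 repr_mx1.
- move=> t s /memT Tt /memT Ts nts; rewrite CE subgK ?(subsetP sTG) //.
  by case: ifPn => // Nts; rewrite (injT t s) ?eqxx in nts.
move=> v v0; apply: ind_eval_inj => g; have [t Tt Ntg] := exT _ (subgP g).
have Gt := subsetP sTG t Tt.
have ->: g = (subg G t * subg G (t^-1 * sgval g))%g.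
  by apply: val_inj; rewrite /= !subgK ?mulKVg // groupM ?groupV ?subgP.
by rewrite ind_evalM // mulmxA v0 ?mul0mx // mem_filter Tt mem_index_enum.
Qed.

End Induction.

(** * Coordinates on a subspace of known dimension *)

Section RowIso.

Import VectorInternalTheory.

Lemma vspace_row_iso (F : fieldType) (vT : vectType F) (U : {vspace vT})
    (d : nat) :
  \dim U = d -> exists phi : 'Hom(subvs_of U, 'rV[F]_d), bijective phi.
Proof.
move<-; pose w : vectType F := subvs_of U.
exists (linfun (@v2r _ w)); exists (@r2v _ w) => u.
  by rewrite lfunE /= v2rK.
by apply: etrans (lfunE _ _) _; apply: r2vK.
Qed.

End RowIso.

Theorem theorem1p6 (F : closedFieldType) (p : nat) (charFp : p \in [pchar F])
    (gT : finGroupType) (G N : {group gT}) (nsNG : N <| G)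
    (p_dvd_N : (p %| #|N|)%N)
    (n : nat) (sigma : mx_representation F N n) (irr_sigma : mx_irreducible sigma)
    (R Q : {set gT})
    (trR : is_transversal R (lcosets (repr_inertia sigma G) G) G)
    (trQ : is_transversal Q (lcosets N (repr_inertia sigma G))
             (repr_inertia sigma G))
    (m : nat) (theta : mx_representation F G m) (irr_theta : mx_irreducible theta)
    (theta_over_sigma : is_subrepr sigma (subg_repr theta (normal_sub nsNG))) :
  let d := #|repr_inertia sigma G : N| in
  let T := (R * Q)%g in
  let l := \dim (hom_space sigma (subg_repr theta (normal_sub nsNG))) in
  is_transversal T (lcosets N G) G /\
  (* 1 *)
  ([/\ mx_rsim (subg_repr (ind_repr G sigma) (normal_sub nsNG)) (conj_sum sigma T),
       mx_rsim (conj_sum sigma T) (muln_grepr (conj_sum sigma R) d),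
       {in R, forall r, mx_irreducible (conj_repr sigma r)}
     & {in R &, forall r s, r != s ->
          ~ mx_rsim (conj_repr sigma r) (conj_repr sigma s)}]) /\
  (* 2 *)
  (exists phi : 'Hom(subvs_of (hom_space (ind_repr G sigma) (ind_repr G sigma)),
                     'rV[F]_d), bijective phi) /\
  (* 3 *)
  mx_rsim (subg_repr theta (normal_sub nsNG)) (muln_grepr (conj_sum sigma R) l).
Proof.
move=> d T l.
(* Algebraic closure enters here, to make Schur's lemma count each equivalent summand once. *)
have abs (k : nat) (rho : mx_representation F N k) :
    mx_irreducible rho -> mx_absolutely_irreducible rho.
  exact: group_closure_closed_field.
have absC x := abs _ _ (mx_irr_conj x irr_sigma).
have sNG := normal_sub nsNG.
pose I := Group (repr_inertia_group_set sigma nsNG).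
have defI : repr_inertia sigma G = I by [].
have sNI : N \subset I := sub_repr_inertia sigma nsNG.
have sIG : I \subset G by apply/subsetP=> x; rewrite inE => /andP[].
have [sRG exR injR] := lcosets_transversalP _ sIG trR.
have trT : is_transversal T (lcosets N G) G :=
  lcosets_transversalM sNI sIG trR trQ.
have sTG := transversal_sub trT.
have countT r : r \in R ->
    count (fun x => r^-1 * x \in I)%g [seq t <- index_enum gT | t \in T] = d.
  move=> Rr; rewrite -[d](card_lcosets_transversalM sNI sIG trR trQ Rr).
  rewrite -sum1_card -sum1_count big_filter_cond.
  by apply: eq_bigl => t; rewrite inE.
have conj_sumE : conj_sum sigma T =
    \big[dadd_grepr/grepr0]_(t <- [seq t <- index_enum gT | t \in T])
      Representation (conj_repr sigma t) by rewrite big_filter.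
have simT := mx_rsim_ind_conj_sum nsNG sigma trT.
split=> //; split; first split=> //.
- rewrite conj_sumE; apply: (dsum_conj_muln nsNG defI trR) => [t|];
    last exact: countT.
  by rewrite mem_filter => /andP[/(subsetP sTG)].
- by move=> r _; apply: mx_irr_conj.
- move=> r s Rr Rs nrs /asboolP.
  rewrite (conj_repr_rsimE nsNG) ?(subsetP sRG) // => Irs.
  by rewrite (injR s r) ?eqxx in nrs.
split.
  (* Reciprocity and the decomposition over [T] reduce the dimension to the number of [t] in [T]
     whose conjugate is equivalent to [sigma]. *)
  apply: vspace_row_iso; rewrite (dim_hom_ind nsNG) (dim_hom_rsiml _ simT).
  rewrite conj_sumE dim_hom_dsuml //; last exact: abs.
  (* [R] need not contain [1], so the elements of [T] in [I] are counted through the representative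
     [r] of the coset [I]. *)
  have [r Rr Ir] := exR 1%g (group1 G); rewrite -(countT r Rr).
  apply: eq_in_count => t; rewrite mem_filter => /andP[/(subsetP sTG) Gt _].
  rewrite /= -[RHS](groupMl _ (groupVr Ir)) mulg1 invgK mulKVg.
  by rewrite inE Gt.
have [s sG sim_s] := Clifford_conj_dsum irr_sigma irr_theta theta_over_sigma.
apply: mx_rsim_trans (sim_s) _; apply: (dsum_conj_muln nsNG defI trR) => // r Rr.
have Gr := subsetP sRG r Rr.
(* Both sides are the multiplicity of the conjugate by [r] in [theta]: [l] by invariance under
   conjugation, the count over [s] by Schur's lemma. *)
rewrite /l -(dim_hom_conj nsNG sigma theta Gr) (dim_hom_rsimr _ sim_s).
rewrite dim_hom_dsumr //; apply: eq_in_count => x /sG Gx /=.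
by rewrite (conj_repr_rsimE nsNG) // defI -[RHS]groupV invMg invgK.
Qed.
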